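(* Let $G$ be a simple graph without isolated vertices such that $\omega(G)\geq 2$. Then $$cc(G)\geq \lceil\log_{\omega(G)}\chi(G)\rceil.$$
   Context: A simple graph is an undirected graph without loops and without multiple edges. A vertex is isolated if it has no neighbours. A clique in $G$ is a complete subgraph of $G$. $\omega(G)$ is the clique number (maximal number of vertices of a clique in $G$) and $\chi(G)$ the chromatic number; both are assumed finite. The clique covering number $cc(G)$ is the least positive integer $k$ such that there are $k$ cliques $G_1,\dots,G_k$ in $G$ with $E(G)=E(G_1)\cup\cdots\cup E(G_k)$; $cc(G)=\infty$ if no such $k$ exists. *)

(* Defs.v *)
From mathcomp Require Import all_boot all_order all_algebra.
From mathcomp Require Import all_classical all_reals all_analysis.

Set Implicit Arguments.
Unset Strict Implicit.
Unset Printing Implicit Defensive.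

Import Order.TTheory GRing.Theory Num.Theory.
Local Open Scope classical_set_scope.
Local Open Scope ring_scope.

(* The vertex type is arbitrary: graphs may be infinite. *)
Record simple_graph (V : Type) := SimpleGraph {
  adj : V -> V -> Prop;
  adj_sym : forall x y, adj x y -> adj y x;
  adj_irrefl : forall x, ~ adj x x
}.

Section SimpleGraphs.
Variables (V : Type) (G : simple_graph V).

Definition isolated_vertex (x : V) : Prop := forall y, ~ adj G x y.

(* An undirected edge {x, y} is represented by both (x, y) and (y, x). *)
Definition edges : set (V * V) := [set p | adj G p.1 p.2].

(* A clique is given by its vertex set. *)
Definition clique (A : set V) : Prop :=
  forall x y, A x -> A y -> x <> y -> adj G x y.

Definition complete_edges (A : set V) : set (V * V) :=
  [set p | [/\ A p.1, A p.2 & p.1 <> p.2]].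

Definition has_clique_of_size (n : nat) : Prop :=
  exists2 A : set V, clique A & (A #= `I_n)%card.

(* If G has an infinite clique then it has finite cliques of every size, so no
   n satisfies this predicate. *)
Definition is_clique_number (n : nat) : Prop :=
  has_clique_of_size n /\ forall m, has_clique_of_size m -> (m <= n)%N.

Definition finite_clique_number : Prop := exists n, is_clique_number n.

(* The value is meaningful only under finite_clique_number. *)
Definition clique_number : nat := xget 0%N is_clique_number.

Definition colorable (k : nat) : Prop :=
  exists f : V -> 'I_k, forall x y, adj G x y -> f x <> f y.

Definition is_chromatic_number (k : nat) : Prop :=
  colorable k /\ forall j, colorable j -> (k <= j)%N.

Definition finite_chromatic_number : Prop := exists k, is_chromatic_number k.

(* The value is meaningful only under finite_chromatic_number. *)
Definition chromatic_number : nat := xget 0%N is_chromatic_number.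

Definition clique_coverable (k : nat) : Prop :=
  exists2 K : 'I_k -> set V, (forall i, clique (K i)) &
    edges = \bigcup_(i in [set: 'I_k]) complete_edges (K i).

Definition is_clique_covering_number (k : nat) : Prop :=
  [/\ (0 < k)%N, clique_coverable k &
    forall j, (0 < j)%N -> clique_coverable j -> (k <= j)%N].

(* Extended integers, so that cc can be compared with a ceiling. *)
Definition clique_covering_number : \bar int :=
  xget +oo%E [set (k%:Z)%:E | k in is_clique_covering_number].

End SimpleGraphs.

Definition logb (R : realType) (b x : R) : R := ln x / ln b.

(* Main.v *)
(* Colour a vertex v by a vector with one entry per clique K_i of a cover.
   Each K_i has at most w := omega(G) vertices, so some map V -> {0,...,w-1} is
   injective on K_i; entry i of the vector is the image of v under this map
   (arbitrary when v lies outside K_i).  Adjacent vertices lie together in some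
   K_i, where their entries differ.  Hence k cliques give chi(G) <= w^k. *)
Require Import Defs.
From mathcomp Require Import all_boot all_order all_algebra.
From mathcomp Require Import all_classical all_reals all_analysis.

Import Order.TTheory GRing.Theory Num.Theory.

(** If [A] is infinite, it contains a copy of the naturals, hence of every initial segment. *)
Lemma card_leII_or_gt (T : Type) (A : set T) (n : nat) :
  (A #<= `I_n)%card \/ (`I_n.+1 #<= A)%card.
Proof.
have [[m /card_eqPle[Am mA]]|/infiniteP infA] := pselect (finite_set A).
  have [le_mn|lt_nm] := leqP m n; [left|right].
    by apply: (card_le_trans Am); rewrite card_le_II.
  by apply: card_le_trans mA; rewrite card_le_II.
by right; apply: card_le_trans infA; exact: subset_card_le.
Qed.

(** A larger clique, even an infinite one, would contain a subclique with exactly [w.+1] vertices,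
    against maximality. *)
Lemma clique_card_le (V : Type) (G : simple_graph V) (A : set V) (w : nat) :
  is_clique_number G w -> clique G A -> (A #<= `I_w)%card.
Proof.
move=> [_ maxw] clA; have [//|/card_subP[C Ccard CA]] := card_leII_or_gt _ A w.
suff /maxw : has_clique_of_size G w.+1 by rewrite ltnn.
by exists C => // x y /CA Ax /CA Ay; exact: clA.
Qed.

Lemma clique_labelling (V : Type) (G : simple_graph V) (A : set V) (w : nat) :
  is_clique_number G w.+1 -> clique G A ->
  exists f : V -> 'I_w.+1, forall x y, A x -> A y -> f x = f y -> x = y.
Proof.
move=> omegaG /(clique_card_le _ _ _ _ omegaG)/pcard_leP[f].
(* Outside [A] the value of [f] may be out of range; [inord] then falls back to 0, which exists as
   the label set has size [w.+1]. *)
exists (fun x => inord (f x)) => x y Ax Ay /(congr1 val).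
have lt_f z : A z -> (f z < w.+1)%N by move=> Az; exact: (@funS _ _ _ _ f).
by rewrite /= !inordK ?lt_f// => /(@inj _ _ _ f); apply; rewrite inE.
Qed.

Lemma colorable_exp_clique_number (V : Type) (G : simple_graph V) (w k : nat) :
  is_clique_number G w.+1 -> clique_coverable G k -> colorable G (w.+1 ^ k).
Proof.
move=> omegaG [K clK edgesE].
have [f f_inj] := choice (fun i => clique_labelling _ _ _ _ omegaG (clK i)).
have cardE : #|{ffun 'I_k -> 'I_w.+1}| = (w.+1 ^ k)%N.
  by rewrite card_ffun !card_ord.
exists (fun v => cast_ord cardE (enum_rank [ffun i => f i v])) => x y xy.
move=> /cast_ord_inj/enum_rank_inj/ffunP fxy.
have : edges G (x, y) by [].
rewrite edgesE => -[i _ [/= Kx Ky]]; apply.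
by apply: (f_inj i) => //; have := fxy i; rewrite !ffunE.
Qed.

Lemma logb_le_nat (R : realType) (b n k : nat) :
  (1 < b)%N -> (n <= b ^ k)%N -> (logb (b%:R : R) (n%:R : R) <= k%:R)%R.
Proof.
move=> b_gt1 le_nbk; have b_gt0 : (0 < b)%N by exact: ltnW.
have lnb_gt0 : (0 < ln (b%:R : R))%R by rewrite ln_gt0 ?ltr1n.
rewrite /logb ler_pdivrMr// mulr_natl.
(* For [n = 0] the convention [ln 0 = 0] gives the bound. *)
have [->|n_gt0] := posnP n; first by rewrite ln0// mulrn_wge0// ltW.
by rewrite -lnXn ?ltr0n// ler_ln ?posrE ?exprn_gt0 ?ltr0n// -natrX ler_nat.
Qed.

Theorem proposition4p7 (R : realType) (V : Type) (G : simple_graph V)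
    (finite_omega : finite_clique_number G)
    (finite_chi : finite_chromatic_number G)
    (no_isolated : forall x : V, ~ isolated_vertex G x)
    (omega_ge2 : (2 <= clique_number G)%N) :
  ((Num.ceil (logb ((clique_number G)%:R : R) ((chromatic_number G)%:R : R)))%:E
     <= clique_covering_number G)%E.
Proof.
have omegaG : is_clique_number G (clique_number G) by exact: xgetPex.
have [_ chi_min] : is_chromatic_number G (chromatic_number G) by exact: xgetPex.
rewrite /clique_covering_number; case: xgetP => [_ -> [k [_ covk _] <-]|_].
  rewrite lee_fin ceil_le_int; apply: logb_le_nat => //; apply: chi_min.
  case: (clique_number G) omega_ge2 omegaG => // w _ omegaG.
  exact: colorable_exp_clique_number.
exact: leey.
Qed.
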